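(* Let $a,b,c$ be positive reals with $a\neq b$, $m$ a positive integer, $k$ a nonnegative integer, $r$ a positive integer, $\overline{\alpha}_r=(\alpha_0,\dots,\alpha_{r-1})$ complex numbers, and let $\alpha,\beta$ be complex parameters such that all Pochhammer symbols $(\alpha+\beta+j+1)_{\ell+1}$ below are nonzero. Then for all real $x$ and $n\in\mathbb{N}_0$, $$M^{[m-1,r]}_{n}(x;k;a,b,c;\overline{\alpha}_{r})=\sum_{j=0}^{n}\sum_{\ell=j}^{n}(-1)^{j}\ell!\binom{n}{n-\ell}(\ln c)^{\ell}\binom{\ell+\alpha}{\ell-j}\frac{\alpha+\beta+2j+1}{(\alpha+\beta+j+1)_{\ell+1}}P^{(\alpha,\beta)}_{j}(1-2x)\,M^{[m-1,r]}_{n-\ell}(k;a,b,c;\overline{\alpha}_{r}).$$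
   Context: $P^{(\alpha,\beta)}_j$ denotes the Jacobi polynomial, $(z)_{p}=z(z+1)\cdots(z+p-1)$, so $(\alpha+\beta+j+1)_{\ell+1}=(\alpha+\beta+j+1)(\alpha+\beta+j+2)\cdots(\alpha+\beta+j+\ell+1)$, and $\binom{z}{p}=z(z-1)\cdots(z-p+1)/p!$. The polynomials $M^{[m-1,r]}_{n}(x;k;a,b,c;\overline{\alpha}_{r})$ are the Taylor coefficients at $t=0$ of $$\frac{t^{rkm}2^{rm(1-k)}c^{xt}}{\prod_{i=0}^{r-1}\left(\alpha_{i}b^{t}-a^{t}\sum_{p=0}^{m-1}\frac{t^{p}}{p!}\right)}=\sum_{n=0}^{\infty}M^{[m-1,r]}_{n}(x;k;a,b,c;\overline{\alpha}_{r})\frac{t^{n}}{n!},$$ the parameters being assumed such that this function is analytic near $t=0$; and $M^{[m-1,r]}_{n}(k;a,b,c;\overline{\alpha}_{r}):=M^{[m-1,r]}_{n}(0;k;a,b,c;\overline{\alpha}_{r})$. *)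

(* Defs.v *)
From Stdlib Require Import Arith ZArith Reals ClassicalEpsilon.
From Coquelicot Require Import Coquelicot.

Open Scope C_scope.

(* [Cprod f p] is the product of [f 0, ..., f (p - 1)] (empty when [p = 0]),
   whereas Coquelicot's [sum_n f p] includes the index [p]. *)
Fixpoint Cprod (f : nat -> C) (p : nat) : C :=
  match p with
  | O => 1
  | S q => Cprod f q * f q
  end.

Definition Cpochhammer (z : C) (p : nat) : C :=
  Cprod (fun i => z + INR i) p.

Definition Cbinom (z : C) (p : nat) : C :=
  Cprod (fun i => z - INR i) p / INR (fact p).

Definition Cexp (z : C) : C :=
  (exp (Re z) * cos (Im z), exp (Re z) * sin (Im z))%R.

(* Principal value of [b ^ z]; meant for [0 < b]. *)
Definition Cpower (b : R) (z : C) : C := Cexp (z * ln b).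

(* Jacobi polynomial for arbitrary complex parameters (Szego, Orthogonal
   Polynomials, formula (4.21.2)):
     P_j(y) = (1/j!) sum_s binom(j,s) (j+al+be+1)_s (al+s+1)_{j-s} ((y-1)/2)^s,
   i.e. (al+1)_j / j! * 2F1(-j, j+al+be+1; al+1; (1-y)/2) with the quotient
   (al+1)_j / (al+1)_s simplified to (al+s+1)_{j-s}, so that negative integer
   values of [al] need not be excluded. *)
Definition jacobi (al be : C) (j : nat) (y : C) : C :=
  / INR (fact j) *
  sum_n (fun s => Cbinom (INR j) s
                  * Cpochhammer (al + be + INR j + 1) s
                  * Cpochhammer (al + INR s + 1) (j - s)
                  * ((y - 1) / 2) ^ s) j.

(* [u n / n!] are the coefficients of the power series of [f] at 0. The point
   0 itself is left out because the functions below are quotients with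
   a possibly removable singularity there. *)
Definition is_taylor_at0 (f : C -> C) (u : nat -> C) : Prop :=
  locally' (0 : C) (fun t : C => is_pseries (fun n => u n / INR (fact n)) t (f t)).

Definition analytic_at0 (f : C -> C) : Prop :=
  exists u : nat -> C, is_taylor_at0 f u.

(* Unspecified unless [analytic_at0 f]. *)
Definition taylor_at0 (f : C -> C) : nat -> C :=
  epsilon (inhabits (fun _ : nat => (0 : C))) (is_taylor_at0 f).

(* Meant for [0 < m]; the entries of the tuple are [alpha 0, ..., alpha (r - 1)],
   the other values of [alpha] are never used. The exponent of 2 may be
   negative. *)
Definition genfun (m r : nat) (x : R) (k : nat) (a b c : R) (alpha : nat -> C)
    (t : C) : C :=
  t ^ (r * k * m) * RtoC (powerRZ 2 (Z.of_nat (r * m) * (1 - Z.of_nat k)))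
    * Cpower c (x * t)
  / Cprod (fun i =>
      alpha i * Cpower b t
      - Cpower a t * sum_n (fun p => t ^ p / INR (fact p)) (m - 1)) r.

Definition Mpoly (m r n : nat) (x : R) (k : nat) (a b c : R)
    (alpha : nat -> C) : C :=
  taylor_at0 (genfun m r x k a b c alpha) n.

(* Main.v *)
(** Multiplying the generating function by [c ^ (x t)] gives, by comparing
    Taylor coefficients, M_n(x) = sum_l binom(n,l) (x ln c)^l M_(n-l)(0), so it
    is enough to expand [x ^ l] in the Jacobi polynomials of [1 - 2 x]. Taking
    the coefficient of [x ^ s] and setting N = l - s, tau = alpha + beta + 2 s,
    that expansion reduces to
      sum_(i <= N) (-1)^i binom(N,i) (tau+2i+1) / (tau+i+1)_(N+1) = [N = 0],
    which telescopes: for N > 0 the sum over i <= I is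
      (-1)^I binom(N-1,I) / (tau+I+2)_N.
    The Taylor coefficients are compared for real [t] only, where [c ^ (x t)]
    is real: the real and imaginary parts of the series are then real power
    series, with the Cauchy product and the identity theorem at hand. *)

Require Import Defs.
From Stdlib Require Import Arith Reals Lia Lra ClassicalEpsilon.
From Coquelicot Require Import Coquelicot.

Open Scope C_scope.

(** * Finite products, rising factorials and binomial coefficients *)

Lemma Cprod_ext_loc (f g : nat -> C) (p : nat) :
  (forall i, (i < p)%nat -> f i = g i) -> Cprod f p = Cprod g p.
Proof.
  induction p as [|p IH]; intros H; simpl; [easy|].
  rewrite IH, H; auto with arith.
Qed.

Lemma Cprod_add (f : nat -> C) (p q : nat) :
  Cprod f (p + q) = Cprod f p * Cprod (fun i => f (p + i)%nat) q.
Proof.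
  induction q as [|q IH]; simpl.
  - rewrite Nat.add_0_r; ring.
  - rewrite Nat.add_succ_r; simpl; rewrite IH; ring.
Qed.

Lemma Cprod_eq_0 (f : nat -> C) (p i : nat) :
  (i < p)%nat -> f i = 0 -> Cprod f p = 0.
Proof.
  induction p as [|p IH]; intros Hi H0; [lia|]; simpl.
  destruct (Nat.eq_dec i p) as [->|Hne].
  - rewrite H0; ring.
  - rewrite IH by (auto; lia); ring.
Qed.

Lemma Cprod_neq_0 (f : nat -> C) (p : nat) :
  (forall i, (i < p)%nat -> f i <> 0) -> Cprod f p <> 0.
Proof.
  induction p as [|p IH]; intros H; simpl.
  - exact C1_nz.
  - apply Cmult_neq_0; auto with arith.
Qed.

Lemma Cprod_neq_0_inv (f : nat -> C) (p i : nat) :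
  (i < p)%nat -> Cprod f p <> 0 -> f i <> 0.
Proof. intros Hi Hp H0; exact (Hp (Cprod_eq_0 f p i Hi H0)). Qed.

Lemma Cprod_rev (f : nat -> C) (p : nat) :
  Cprod f p = Cprod (fun i => f (p - 1 - i)%nat) p.
Proof.
  revert f; induction p as [|p IH]; intros f; [easy|].
  change (S p) with (1 + p)%nat at 1; rewrite Cprod_add, IH; simpl.
  rewrite (Cprod_ext_loc (fun i => f (S (p - 1 - i))) (fun i => f (p - 0 - i)%nat)).
  - replace (p - 0 - p)%nat with 0%nat by lia; ring.
  - intros i Hi; f_equal; lia.
Qed.

Lemma Cpochhammer_add (z : C) (p q : nat) :
  Cpochhammer z (p + q) = Cpochhammer z p * Cpochhammer (z + INR p) q.
Proof.
  unfold Cpochhammer; rewrite Cprod_add; f_equal.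
  apply Cprod_ext_loc; intros i _; rewrite plus_INR, RtoC_plus; ring.
Qed.

Lemma Cpochhammer_1 (z : C) : Cpochhammer z 1 = z.
Proof. unfold Cpochhammer; simpl; ring. Qed.

(* [ring] and [field] recognize neither [C_AbelianMonoid] nor any other
   Coquelicot structure on [C] as the type of an equation. *)
Ltac Ceq := match goal with |- ?x = ?y => change (@eq C x y) end.

Lemma RtoC_neq_0 (x : R) : x <> 0%R -> RtoC x <> 0.
Proof. intros Hx H; apply Hx, RtoC_inj, H. Qed.

Lemma RtoC_S_INR (n : nat) : RtoC (INR (S n)) = INR n + 1.
Proof. now rewrite S_INR, RtoC_plus. Qed.

Lemma RtoC_fact_neq_0 (n : nat) : RtoC (INR (fact n)) <> 0.
Proof. apply RtoC_neq_0, INR_fact_neq_0. Qed.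

Lemma RtoC_fact_S (n : nat) :
  RtoC (INR (fact (S n))) = (INR n + 1) * INR (fact n).
Proof.
  change (fact (S n)) with (S n * fact n)%nat.
  now rewrite mult_INR, RtoC_mult, RtoC_S_INR.
Qed.

Lemma Cbinom_INR (n p : nat) :
  (p <= n)%nat ->
  Cbinom (INR n) p = INR (fact n) / (INR (fact p) * INR (fact (n - p))).
Proof.
  intros Hp; unfold Cbinom.
  assert (H : Cprod (fun i => INR n - INR i) p * INR (fact (n - p)) = INR (fact n)).
  { induction p as [|p IH]; simpl Cprod.
    - rewrite Nat.sub_0_r; ring.
    - rewrite <- IH by lia; replace (n - p)%nat with (S (n - S p)) by lia.
      rewrite RtoC_fact_S.
      assert (E : RtoC (INR n) = INR (n - S p) + INR p + 1).
      { rewrite <- RtoC_plus, <- plus_INR, <- RtoC_S_INR; do 2 f_equal; lia. }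
      set (Q := Cprod _ p); clearbody Q; rewrite E; ring. }
  rewrite <- H; field; split; apply RtoC_fact_neq_0.
Qed.

(** Read backwards, the falling product starts at its last factor [z + j + 1] and rises. *)
Lemma Cbinom_Cpochhammer (z : C) (j p : nat) :
  Cbinom (INR (j + p) + z) p = Cpochhammer (z + INR j + 1) p / INR (fact p).
Proof.
  unfold Cbinom, Cpochhammer; f_equal.
  rewrite Cprod_rev; apply Cprod_ext_loc; intros i Hi.
  replace (j + p)%nat with (S (j + (p - 1 - i) + i)) by lia.
  rewrite RtoC_S_INR, !plus_INR, !RtoC_plus; ring.
Qed.

(** * Finite sums and exchange of summations *)

Lemma Csum_S (f : nat -> C) (n : nat) : sum_n f (S n) = sum_n f n + f (S n).
Proof. exact (sum_Sn f n). Qed.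

Lemma Csum_mult_l (a : C) (f : nat -> C) (n : nat) :
  sum_n (fun i => a * f i) n = a * sum_n f n.
Proof. exact (sum_n_mult_l (K := C_Ring) a f n). Qed.

Lemma sum_n_zero_loc {G : AbelianMonoid} (f : nat -> G) (n : nat) :
  (forall i, (i <= n)%nat -> f i = zero) -> sum_n f n = zero.
Proof.
  intros H; rewrite (sum_n_ext_loc f (fun _ => zero)) by exact H.
  apply sum_n_m_const_zero.
Qed.

Lemma sum_n_below {G : AbelianMonoid} (f : nat -> G) (j n : nat) :
  (j <= n)%nat ->
  sum_n (fun s => if le_dec s j then f s else zero) n = sum_n f j.
Proof.
  intros Hj; induction Hj as [|n Hj IH].
  - apply sum_n_ext_loc; intros s Hs; now destruct (le_dec s j).
  - rewrite sum_Sn, IH; destruct (le_dec (S n) j); [lia|apply plus_zero_r].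
Qed.

Lemma sum_n_above {G : AbelianMonoid} (f : nat -> G) (s n : nat) :
  (s <= n)%nat ->
  sum_n (fun j => if le_dec s j then f j else zero) n = sum_n_m f s n.
Proof.
  intros Hs; destruct s as [|s].
  - apply sum_n_ext; intros j; destruct (le_dec 0 j); [easy|lia].
  - unfold sum_n; rewrite (sum_n_m_Chasles _ 0 s n) by lia.
    fold (sum_n (fun j => if le_dec (S s) j then f j else zero) s).
    rewrite sum_n_zero_loc.
    + rewrite plus_zero_l; apply sum_n_m_ext_loc; intros j Hj.
      destruct (le_dec (S s) j); [easy|lia].
    + intros j Hj; destruct (le_dec (S s) j); [lia|easy].
Qed.

Lemma sum_n_m_shift {G : AbelianMonoid} (f : nat -> G) (s n : nat) :
  sum_n_m f s (s + n) = sum_n (fun i => f (s + i)%nat) n.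
Proof.
  revert f; induction s as [|s IH]; intros f; simpl; [easy|].
  now rewrite <- sum_n_m_S, IH.
Qed.

(** Padding the inner sums with zeros turns the triangle [j <= l <= n] into a square, where the
    order of summation can be exchanged. *)
Lemma sum_n_triangle {G : AbelianMonoid} (f : nat -> nat -> G) (n : nat) :
  sum_n (fun j => sum_n_m (f j) j n) n =
  sum_n (fun l => sum_n (fun j => f j l) l) n.
Proof.
  rewrite (sum_n_ext_loc _
    (fun j => sum_n (fun l => if le_dec j l then f j l else zero) n)).
  - rewrite sum_n_switch; apply sum_n_ext_loc; intros l Hl.
    now rewrite (sum_n_below (fun j => f j l)).
  - intros j Hj; now rewrite (sum_n_above (f j)).
Qed.

(** * The telescoping orthogonality sum *)

(* With [tau = al + be + 2 s] and [i = j - s], this is, up to a factor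
   independent of [j], the coefficient of [x ^ s] in the [j]-th term of the
   Jacobi expansion of [x ^ (N + s)]. *)
Definition orthogonality_term (tau : C) (N i : nat) : C :=
  (-1) ^ i / (INR (fact i) * INR (fact (N - i)))
  * ((tau + 2 * INR i + 1) / Cpochhammer (tau + INR i + 1) (N + 1)).

Lemma Cpochhammer_neq_0 (tau : C) (i p : nat)
  (Htau : forall i : nat, tau + INR i + 1 <> 0) : Cpochhammer (tau + INR i + 1) p <> 0.
Proof.
  apply Cprod_neq_0; intros q _.
  replace (tau + INR i + 1 + INR q) with (tau + INR (i + q) + 1); auto.
  rewrite plus_INR, RtoC_plus; ring.
Qed.

(** Induction on [I] verifies the telescoping. With [N = S M], the value is
    [(-1)^I binom(N-1,I) / (tau+I+2)_N] divided by [N!], since the terms carry [1 / (i! (N-i)!)] in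
    place of the binomial. *)
Lemma orthogonality_partial_sum (tau : C) (M I : nat)
  (Htau : forall i : nat, tau + INR i + 1 <> 0) : (I <= M)%nat ->
  sum_n (orthogonality_term tau (S M)) I =
  (-1) ^ I / (INR (S M) * INR (fact I) * INR (fact (M - I))
              * Cpochhammer (tau + INR (S I) + 1) (S M)).
Proof.
  assert (HM : RtoC (INR M) + 1 <> 0).
  { rewrite <- RtoC_S_INR; apply RtoC_neq_0, not_0_INR; lia. }
  induction I as [|I IH]; intros HI.
  - rewrite sum_O; unfold orthogonality_term; rewrite !Nat.sub_0_r.
    replace (S M + 1)%nat with (1 + S M)%nat by lia.
    rewrite Cpochhammer_add, Cpochhammer_1, RtoC_fact_S, (RtoC_S_INR M).
    replace (tau + INR 0 + 1 + INR 1) with (tau + INR 1 + 1) by (simpl; ring).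
    pose proof (Cpochhammer_neq_0 tau 1 (S M) Htau) as HP; pose proof (Htau 0%nat) as H0.
    set (P := Cpochhammer _ (S M)) in *; clearbody P.
    simpl (INR 0) in *; simpl (fact 0); simpl Cpow. simpl (INR 1).
    Ceq; field; repeat split; auto using RtoC_fact_neq_0, C1_nz.
    replace (tau + 1) with (tau + 0 + 1) by ring; exact H0.
  - rewrite Csum_S, IH by lia; unfold orthogonality_term.
    (* Writing [M = K + S I] removes every truncated subtraction from the factorials. *)
    destruct (Nat.le_exists_sub (S I) M HI) as [K [HK _]].
    replace (M - I)%nat with (S K) by lia.
    replace (M - S I)%nat with K by lia.
    replace (S M - S I)%nat with (S K) by lia.
    replace (S M + 1)%nat with (1 + S M)%nat by lia.
    rewrite (Cpochhammer_add _ 1 (S M)), Cpochhammer_1.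
    change (INR 1) with 1%R.
    (* Both Pochhammer symbols are reduced to the common block [(tau+I+3)_M]: one loses its first
       factor, the other its last. *)
    assert (E1 : Cpochhammer (tau + INR (S I) + 1) (S M) =
       (tau + INR I + 1 + 1) * Cpochhammer (tau + INR (S (S I)) + 1) M).
    { change (S M) with (1 + M)%nat.
      rewrite Cpochhammer_add, Cpochhammer_1; change (INR 1) with 1%R.
      rewrite !RtoC_S_INR; f_equal; [ring|f_equal; ring]. }
    assert (E2 : Cpochhammer (tau + INR (S (S I)) + 1) (S M) =
       Cpochhammer (tau + INR (S (S I)) + 1) M * (tau + INR (S (S I)) + 1 + INR M)).
    { replace (S M) with (M + 1)%nat by lia.
      now rewrite Cpochhammer_add, Cpochhammer_1. }
    replace (tau + INR (S I) + 1 + 1) with (tau + INR (S (S I)) + 1)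
      by (rewrite !RtoC_S_INR; ring).
    rewrite E1, E2.
    pose proof (Cpochhammer_neq_0 tau (S (S I)) M Htau) as HP.
    pose proof (Htau (S I)) as H1.
    pose proof (Htau (S (S I) + M)%nat) as H2.
    set (P := Cpochhammer _ M) in *; clearbody P.
    rewrite !RtoC_fact_S, !RtoC_S_INR in *.
    assert (EM : RtoC (INR M) = INR K + INR I + 1).
    { rewrite HK, plus_INR, RtoC_plus, RtoC_S_INR; ring. }
    assert (HK' : RtoC (INR K) + 1 <> 0)
      by (rewrite <- RtoC_S_INR; apply RtoC_neq_0, not_0_INR; lia).
    assert (HI' : RtoC (INR I) + 1 <> 0)
      by (rewrite <- RtoC_S_INR; apply RtoC_neq_0, not_0_INR; lia).
    rewrite plus_INR, RtoC_plus, !RtoC_S_INR in H2.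
    rewrite EM in *; simpl Cpow.
    Ceq; field; repeat split; auto using RtoC_fact_neq_0.
    intros E; apply H2; rewrite <- E; ring.
Qed.

Lemma orthogonality_sum (tau : C) (N : nat)
  (Htau : forall i : nat, tau + INR i + 1 <> 0) :
  sum_n (orthogonality_term tau N) N = (if Nat.eq_dec N 0 then RtoC 1 else RtoC 0).
Proof.
  destruct N as [|M]; simpl Nat.eq_dec; cbv iota.
  - rewrite sum_O; unfold orthogonality_term; simpl; unfold Cpochhammer; simpl.
    pose proof (Htau 0%nat) as H; simpl in H; rewrite Cplus_0_r in H.
    Ceq; field; exact H.
  (* In the term [i = S M] the numerator cancels the last Pochhammer factor; what remains is the
     opposite of the partial sum up to [M]. *)
  - rewrite Csum_S, orthogonality_partial_sum by (auto; lia); unfold orthogonality_term.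
    rewrite !Nat.sub_diag.
    rewrite Cpochhammer_add, Cpochhammer_1.
    pose proof (Cpochhammer_neq_0 tau (S M) (S M) Htau) as HP.
    pose proof (Htau (S M + S M)%nat) as H1.
    set (P := Cpochhammer _ (S M)) in *; clearbody P.
    rewrite plus_INR, RtoC_plus in H1.
    rewrite RtoC_fact_S, RtoC_S_INR in *; simpl Cpow; simpl (fact 0).
    assert (HM : RtoC (INR M) + 1 <> 0)
      by (rewrite <- RtoC_S_INR; apply RtoC_neq_0, not_0_INR; lia).
    simpl (INR 1).
    Ceq; field; repeat split; auto using RtoC_fact_neq_0, C1_nz; intros E;
      apply H1; rewrite <- E; ring.
Qed.

Lemma Cpow_opp_same (z : C) (n : nat) : (-1) ^ n * (- z) ^ n = z ^ n.
Proof. rewrite <- Cpow_mult_l; f_equal; ring. Qed.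

(** * Expansion of powers in Jacobi polynomials *)

(* The factors [(al + s + 1)_(j - s)] of the Jacobi polynomial and
   [(al + j + 1)_(l - j)] of the binomial combine to [(al + s + 1)_(l - s)],
   which no longer depends on [j]. *)
Lemma power_jacobi (al be x : C) (l : nat)
  (Hab : forall i : nat, al + be + INR i + 1 <> 0) :
  sum_n (fun j =>
    (-1) ^ j * INR (fact l) * Cbinom (INR l + al) (l - j)
    * ((al + be + 2 * INR j + 1) / Cpochhammer (al + be + INR j + 1) (l + 1))
    * jacobi al be j (1 - 2 * x)) l = x ^ l.
Proof.
  (* [T j s] is the [x ^ s] part of the [j]-th summand; the Jacobi argument gives
     [((1 - 2 x) - 1) / 2 = - x]. *)
  set (T := fun j s : nat =>
    (-1) ^ j * INR (fact l) * Cbinom (INR l + al) (l - j)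
    * ((al + be + 2 * INR j + 1) / Cpochhammer (al + be + INR j + 1) (l + 1))
    * (/ INR (fact j) * (Cbinom (INR j) s
                  * Cpochhammer (al + be + INR j + 1) s
                  * Cpochhammer (al + INR s + 1) (j - s)
                  * (- x) ^ s))).
  transitivity (sum_n (fun j =>
    sum_n (fun s => (if le_dec s j then T j s else RtoC 0)) l) l).
  { apply sum_n_ext_loc; intros j Hj.
    rewrite (sum_n_below (T j)) by exact Hj; unfold jacobi, T.
    rewrite !Csum_mult_l; do 2 f_equal; apply sum_n_ext; intros s.
    do 2 f_equal; unfold Cdiv; field; apply RtoC_neq_0; lra. }
  rewrite sum_n_switch.
  transitivity (sum_n (fun s => (if Nat.eq_dec s l then x ^ l else RtoC 0)) l).
  2:{ destruct l as [|l].
      - now rewrite sum_O.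
      - rewrite Csum_S, sum_n_zero_loc.
        + destruct (Nat.eq_dec (S l) (S l)) as [_|Hn]; [|easy].
          exact (Cplus_0_l _).
        + intros s Hs; destruct (Nat.eq_dec s (S l)); [lia|easy]. }
  (* For fixed [s] only [j >= s] contributes; the shift [j = s + i] brings the sum to the form of
     [orthogonality_sum]. *)
  apply sum_n_ext_loc; intros s Hs.
  rewrite (sum_n_above (fun j => T j s)) by exact Hs.
  replace l with (s + (l - s))%nat at 1 by lia.
  rewrite sum_n_m_shift.
  (* For [tau = al + be + 2 s] this is [Hab] at the index [2 s + i]. *)
  assert (Htau : forall i : nat, al + be + 2 * INR s + INR i + 1 <> 0).
  { intros i; specialize (Hab (s + s + i)%nat).
    rewrite !plus_INR, !RtoC_plus in Hab; intros E; apply Hab.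
    rewrite <- E; ring. }
  rewrite (sum_n_ext_loc _ (fun i =>
    INR (fact l) / INR (fact s) * Cpochhammer (al + INR s + 1) (l - s) * x ^ s *
    orthogonality_term (al + be + 2 * INR s) (l - s) i)).
  - rewrite Csum_mult_l, (orthogonality_sum _ _ Htau).
    destruct (Nat.eq_dec s l) as [->|Hne]; destruct (Nat.eq_dec (l - _) 0); try lia.
    + rewrite Nat.sub_diag; unfold Cpochhammer; simpl Cprod.
      Ceq; field; apply RtoC_fact_neq_0.
    + apply Cmult_0_r.
  - intros i Hi; unfold T, orthogonality_term.
    rewrite Cbinom_INR by lia.
    replace (s + i - s)%nat with i by lia.
    replace (l - (s + i))%nat with (l - s - i)%nat by lia.
    replace (Cbinom (INR l + al) (l - s - i)) with
      (Cbinom (INR (s + i + (l - s - i)) + al) (l - s - i))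
      by (do 4 f_equal; lia).
    rewrite Cbinom_Cpochhammer.
    (* The first [s] factors of the denominator cancel [(al+be+j+1)_s] from the Jacobi polynomial,
       leaving [(tau+i+1)_(l-s+1)]. *)
    replace (l + 1)%nat with (s + (l - s + 1))%nat by lia.
    rewrite (Cpochhammer_add _ s (l - s + 1)).
    replace (Cpochhammer (al + INR s + 1) (l - s)) with
      (Cpochhammer (al + INR s + 1) i *
       Cpochhammer (al + INR (s + i) + 1) (l - s - i)).
    2:{ replace (l - s)%nat with (i + (l - s - i))%nat at 2 by lia.
        rewrite Cpochhammer_add, plus_INR, RtoC_plus; do 2 f_equal; ring. }
    replace (al + be + INR (s + i) + 1 + INR s) with
      (al + be + 2 * INR s + INR i + 1)
      by (rewrite plus_INR, RtoC_plus; ring).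
    (* The sign [(-1)^s] in [(-1)^(s+i)] absorbs that of [(- x)^s]. *)
    rewrite Cpow_add_r, <- (Cpow_opp_same x s).
    pose proof (Cpochhammer_neq_0 _ (s + i) s Hab) as P1.
    pose proof (Cpochhammer_neq_0 _ i (l - s + 1) Htau) as P2.
    set (p1 := Cpochhammer _ s) in *; clearbody p1.
    set (p2 := Cpochhammer _ (l - s + 1)) in *; clearbody p2.
    rewrite plus_INR, RtoC_plus.
    Ceq; field; repeat split; auto using RtoC_fact_neq_0.
Qed.

(** * Restriction of complex power series to the real axis *)

Lemma locally'_RtoC (P : C -> Prop) :
  locally' (0 : C) P -> locally' (0 : R) (fun t : R => P (RtoC t)).
Proof.
  intros [e He]; exists e; intros t Ht Hne; apply He.
  - split; [exact Ht | apply ball_center].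
  - intros E; apply Hne, RtoC_inj, E.
Qed.

Lemma sum_n_fst (f : nat -> C) (n : nat) :
  fst (sum_n f n) = sum_n (fun k => fst (f k)) n.
Proof.
  induction n as [|n IH]; [now rewrite !sum_O|].
  now rewrite !sum_Sn, <- IH.
Qed.

Lemma sum_n_snd (f : nat -> C) (n : nat) :
  snd (sum_n f n) = sum_n (fun k => snd (f k)) n.
Proof.
  induction n as [|n IH]; [now rewrite !sum_O|].
  now rewrite !sum_Sn, <- IH.
Qed.

Lemma pow_n_RtoC (t : R) (n : nat) :
  pow_n (K := C_Ring) (RtoC t) n = RtoC (pow_n (K := R_Ring) t n).
Proof.
  induction n as [|n IH]; simpl; [easy|].
  rewrite IH; symmetry; apply RtoC_mult.
Qed.

(** A real [t] has real powers, which scale real parts separately, and the projection is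
    continuous. *)
Lemma is_pseries_Re (a : nat -> C) (t : R) (l : C) :
  is_pseries (K := C_AbsRing) (V := C_NormedModule) a (RtoC t) l ->
  is_pseries (fun n => Re (a n)) t (Re l).
Proof.
  intros H; unfold is_pseries, is_series in *.
  apply (filterlim_ext (fun n => fst (sum_n (G := C_NormedModule)
    (fun k => scal (pow_n (K := C_Ring) (RtoC t) k) (a k)) n))).
  - intros n; etransitivity; [apply sum_n_fst|].
    apply sum_n_ext; intros k; rewrite pow_n_RtoC; apply re_scal_l.
  - eapply filterlim_comp; [exact H|]; apply continuous_fst.
Qed.

Lemma is_pseries_Im (a : nat -> C) (t : R) (l : C) :
  is_pseries (K := C_AbsRing) (V := C_NormedModule) a (RtoC t) l ->
  is_pseries (fun n => Im (a n)) t (Im l).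
Proof.
  intros H; unfold is_pseries, is_series in *.
  apply (filterlim_ext (fun n => snd (sum_n (G := C_NormedModule)
    (fun k => scal (pow_n (K := C_Ring) (RtoC t) k) (a k)) n))).
  - intros n; etransitivity; [apply sum_n_snd|].
    apply sum_n_ext; intros k; rewrite pow_n_RtoC; apply im_scal_l.
  - eapply filterlim_comp; [exact H|]; apply continuous_snd.
Qed.

(** * Real power series: identity theorem and Cauchy product *)

Open Scope R_scope.

(** Beyond the radius of convergence the terms do not tend to 0. *)
Lemma is_pseries_CV_radius (a : nat -> R) (t l : R) :
  is_pseries a t l -> Rbar_le (Rabs t) (CV_radius a).
Proof.
  intros H; apply Rbar_not_lt_le; intros Hlt.
  apply (CV_disk_outside a t Hlt), ex_series_lim_0.
  exists l; now apply is_pseries_R.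
Qed.

Lemma locally'_0_pos (P : R -> Prop) :
  locally' 0 P -> exists t : R, 0 < t /\ P t.
Proof.
  intros [e He]; exists (e / 2).
  pose proof (cond_pos e) as He0; split; [lra|]; apply He; [|lra].
  change (Rabs (e / 2 - 0) < e); rewrite Rabs_right; lra.
Qed.

Lemma locally'_pseries_CV_radius (a : nat -> R) (f : R -> R) :
  locally' 0 (fun t => is_pseries a t (f t)) -> Rbar_lt 0 (CV_radius a).
Proof.
  intros H; destruct (locally'_0_pos _ H) as [t [Ht Ha]].
  apply is_pseries_CV_radius in Ha; rewrite Rabs_right in Ha by lra.
  now apply (Rbar_lt_le_trans _ t).
Qed.

(** Both sums are continuous at 0, so equality on a punctured neighbourhood extends to 0 by
    uniqueness of limits; the identity theorem then applies. *)
Lemma PSeries_ext_recip' (a b : nat -> R) (n : nat) :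
  Rbar_lt 0 (CV_radius a) -> Rbar_lt 0 (CV_radius b) ->
  locally' 0 (fun t => PSeries a t = PSeries b t) -> a n = b n.
Proof.
  intros Ha Hb H; apply PSeries_ext_recip; auto.
  assert (H0 : PSeries a 0 = PSeries b 0).
  { assert (L : forall c, Rbar_lt 0 (CV_radius c) ->
      filterlim (PSeries c) (locally' 0) (locally (PSeries c 0))).
    { intros c Hc; apply (is_lim_continuity (PSeries c) 0).
      apply PSeries_continuity; now rewrite Rabs_R0. }
    apply (filterlim_locally_unique (F := Rbar_locally' 0) (PSeries b)); auto.
    apply (filterlim_ext_loc (PSeries a)); auto. }
  destruct H as [e He]; exists e; intros t Ht.
  destruct (Req_dec t 0) as [->|Hne]; [exact H0|now apply He].
Qed.

(** The series [b] and the Cauchy product both represent [g * f] near 0, so their coefficients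
    agree. *)
Lemma PS_mult_coef (e a b : nat -> R) (g f : R -> R) :
  (forall t, is_pseries e t (g t)) ->
  locally' 0 (fun t => is_pseries a t (f t)) ->
  locally' 0 (fun t => is_pseries b t (g t * f t)) ->
  forall n, b n = PS_mult e a n.
Proof.
  intros He Ha Hb n.
  pose proof (locally'_pseries_CV_radius _ _ Ha) as Ra.
  (* Convergence of [e] at [Rabs t + 1] puts [t] strictly inside its disk. *)
  assert (Ce : forall t, Rbar_lt (Rabs t) (CV_radius e)).
  { intros t; apply (Rbar_lt_le_trans _ (Rabs (Rabs t + 1))).
    - simpl; pose proof (Rabs_pos t); rewrite (Rabs_right (Rabs t + 1)); lra.
    - exact (is_pseries_CV_radius _ _ _ (He _)). }
  assert (Hm : locally' 0 (fun t => is_pseries (PS_mult e a) t (g t * f t))).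
  { assert (Hr : locally' 0 (fun t => Rbar_lt (Rabs t) (CV_radius a))).
    { destruct (locally'_0_pos _ Ha) as [d [Hd Hda]].
      apply is_pseries_CV_radius in Hda; rewrite Rabs_right in Hda by lra.
      exists (mkposreal d Hd); intros t Ht _.
      apply (Rbar_lt_le_trans _ d); auto.
      change (Rabs (t - 0) < d) in Ht; now rewrite Rminus_0_r in Ht. }
    generalize (filter_and _ _ Ha Hr); apply filter_imp.
    intros t [H1 H2]; now apply is_pseries_mult. }
  apply PSeries_ext_recip';
    [exact (locally'_pseries_CV_radius _ _ Hb)
    |exact (locally'_pseries_CV_radius _ _ Hm)|].
  generalize (filter_and _ _ Hb Hm); apply filter_imp.
  intros t [H1 H2].
  now rewrite (is_pseries_unique _ _ _ H1), (is_pseries_unique _ _ _ H2).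
Qed.

Lemma is_pseries_exp_scal (L t : R) :
  is_pseries (fun n => L ^ n / INR (fact n)) t (exp (L * t)).
Proof.
  apply is_pseries_R.
  apply (is_series_ext (fun n => / INR (fact n) * (L * t) ^ n)).
  - intros n; change (/ INR (fact n) * (L * t) ^ n = L ^ n / INR (fact n) * t ^ n).
    rewrite Rpow_mult_distr; unfold Rdiv; ring.
  - apply is_pseries_R, is_exp_Reals.
Qed.

(** * Taylor coefficients of the generating function *)

Open Scope C_scope.

(** For real [t] the factor [exp (L * t)] is real, hence multiplies real and imaginary parts
    separately, and [PS_mult_coef] applies to each. *)
Lemma taylor_coef_exp_mult (f g : C -> C) (u v : nat -> C) (L : R) :
  is_taylor_at0 f u -> is_taylor_at0 g v ->
  (forall t : R, g t = RtoC (exp (L * t)) * f t) ->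
  forall n : nat, v n / INR (fact n) =
    sum_n (fun l => RtoC (L ^ l / INR (fact l))
                    * (u (n - l)%nat / INR (fact (n - l)))) n.
Proof.
  intros Hu Hv Hg n; apply locally'_RtoC in Hu, Hv.
  apply injective_projections.
  - change (Re (v n / INR (fact n))  = fst (sum_n (fun l => RtoC (L ^ l / INR (fact l))
                    * (u (n - l)%nat / INR (fact (n - l)))) n)).
    rewrite (PS_mult_coef _ (fun n => Re (u n / INR (fact n)))
      (fun n => Re (v n / INR (fact n))) _ (fun t => Re (f t)) (is_pseries_exp_scal L)).
    + unfold PS_mult; rewrite <- sum_n_Reals, sum_n_fst.
      apply sum_n_ext; intros k; symmetry; apply re_scal_l.
    + revert Hu; apply filter_imp; intros t; apply is_pseries_Re.
    + revert Hv; apply filter_imp; intros t Ht.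
      rewrite <- re_scal_l, <- Hg; now apply is_pseries_Re.
  - change (Im (v n / INR (fact n))  = snd (sum_n (fun l => RtoC (L ^ l / INR (fact l))
                    * (u (n - l)%nat / INR (fact (n - l)))) n)).
    rewrite (PS_mult_coef _ (fun n => Im (u n / INR (fact n)))
      (fun n => Im (v n / INR (fact n))) _ (fun t => Im (f t)) (is_pseries_exp_scal L)).
    + unfold PS_mult; rewrite <- sum_n_Reals, sum_n_snd.
      apply sum_n_ext; intros k; symmetry; apply im_scal_l.
    + revert Hu; apply filter_imp; intros t; apply is_pseries_Im.
    + revert Hv; apply filter_imp; intros t Ht.
      rewrite <- im_scal_l, <- Hg; now apply is_pseries_Im.
Qed.

Lemma taylor_at0_correct (f : C -> C) :
  analytic_at0 f -> is_taylor_at0 f (taylor_at0 f).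
Proof. intros H; unfold taylor_at0; now apply epsilon_spec. Qed.

Lemma Cpower_real (c s : R) : Cpower c s = RtoC (exp (s * ln c)).
Proof.
  unfold Cpower, Cexp; rewrite <- RtoC_mult, re_RtoC, im_RtoC, cos_0, sin_0.
  now rewrite Rmult_1_r, Rmult_0_r.
Qed.

Lemma genfun_shift (m r : nat) (x : R) (k : nat) (a b c : R) (alphas : nat -> C)
  (t : R) :
  genfun m r x k a b c alphas t =
  RtoC (exp (x * ln c * t)) * genfun m r 0 k a b c alphas t.
Proof.
  unfold genfun; rewrite <- !RtoC_mult, !Cpower_real.
  rewrite !Rmult_0_l, exp_0.
  replace (x * ln c * t)%R with (x * t * ln c)%R by ring.
  unfold Cdiv; ring.
Qed.

Theorem theorem4p4 (a b c : R) (m k r : nat) (alphas : nat -> C) (alpha beta : C)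
  (ha : (0 < a)%R) (hb : (0 < b)%R) (hc : (0 < c)%R) (hab : a <> b)
  (hm : (0 < m)%nat) (hr : (0 < r)%nat)
  (hanalytic : forall x : R, analytic_at0 (genfun m r x k a b c alphas))
  (hpoch : forall j l : nat, (j <= l)%nat ->
     Cpochhammer (alpha + beta + INR j + 1) (l + 1) <> 0) :
  forall (x : R) (n : nat),
    Mpoly m r n x k a b c alphas =
    sum_n (fun j =>
      sum_n_m (fun l =>
        (-1) ^ j * INR (fact l) * Cbinom (INR n) (n - l)
        * RtoC (ln c) ^ l
        * Cbinom (INR l + alpha) (l - j)
        * ((alpha + beta + 2 * INR j + 1)
           / Cpochhammer (alpha + beta + INR j + 1) (l + 1))
        * jacobi alpha beta j (1 - 2 * x)
        * Mpoly m r (n - l) 0 k a b c alphas) j n) n.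
Proof.
  intros x n.
  (* [alpha + beta + i + 1] is the last factor of the symbol in [hpoch] for [j = 0], [l = i]. *)
  assert (Hab : forall i : nat, alpha + beta + INR i + 1 <> 0).
  { intros i; specialize (hpoch 0%nat i (Nat.le_0_l i)).
    apply (Cprod_neq_0_inv _ _ i) in hpoch; [|lia].
    intros E; apply hpoch; rewrite <- E; simpl; ring. }
  pose proof (taylor_coef_exp_mult _ _ _ _ _
    (taylor_at0_correct _ (hanalytic 0%R)) (taylor_at0_correct _ (hanalytic x))
    (genfun_shift m r x k a b c alphas) n) as HM.
  (* With [l] as the outer index, the two sides can be compared term by term in [l]. *)
  rewrite sum_n_triangle; unfold Mpoly.
  set (u := taylor_at0 (genfun m r 0 k a b c alphas)) in *.
  set (v := taylor_at0 (genfun m r x k a b c alphas)) in *.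
  transitivity (INR (fact n) * (v n / INR (fact n))).
  { field; apply RtoC_fact_neq_0. }
  rewrite HM, <- Csum_mult_l; apply sum_n_ext_loc; intros l Hl.
  (* The intermediate form isolates [x ^ l], which [power_jacobi] then expands. *)
  transitivity (Cbinom (INR n) (n - l) * RtoC (ln c) ^ l * u (n - l)%nat
                * RtoC x ^ l).
  - rewrite Cbinom_INR by lia; replace (n - (n - l))%nat with l by lia.
    rewrite RtoC_div, RtoC_pow, RtoC_mult, Cpow_mult_l by apply INR_fact_neq_0.
    Ceq; field; repeat split; apply RtoC_fact_neq_0.
  - rewrite <- (power_jacobi alpha beta x l Hab), <- Csum_mult_l.
    apply sum_n_ext; intros j; Ceq; unfold Cdiv; ring.
Qed.
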